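(* For the uniform matroid $U(n,\rho)$ (ground set $R$, $|R|=n$, independent sets all subsets of size at most $\rho$) with total order $\succ$, consider the following algorithm. Draw $n$ independent uniform times in $[0,1)$, sorted as $t_1<\dots<t_n$, and let $t_i$ be the arrival time of $r_i$ (so the arrival order is uniformly random). For $j\ge0$ let $I_j=[0,2^{-j})$ and $J_j=[2^{-j-1},2^{-j})$. Set $\mathrm{ALG}\gets\emptyset$; for $i=1,\dots,n$: let $j$ be such that $t_i\in J_j$; let $f_j$ be the $\lceil 2^{-(j+1)}(1+\varepsilon_j)\rho\rceil$-th highest (under $\succ$) element among the elements of $\{r_1,\dots,r_i\}$ whose arrival time lies in $I_{j+1}$; if fewer than $2^{-(j+1)}\rho$ elements with arrival time in $J_j$ have been selected and $r_i\succ f_j$, add $r_i$ to $\mathrm{ALG}$. Return $\mathrm{ALG}$. Here $\varepsilon_j=\sqrt{12\cdot2^j\ln\rho/\rho}$ for $0\le j\le\lfloor\frac12\log_2(\rho/96)\rfloor$, and $\varepsilon_j\ge0$ arbitrary for larger $j$. Then this algorithm is $1+O(\sqrt{\log\rho/\rho})$ probability-competitive, i.e., for every $e\in\mathrm{OPT}$ (the $\rho$ highest elements), $\Pr(e\in\mathrm{ALG})\ge 1/(1+O(\sqrt{\log\rho/\rho}))$, with the $O(\cdot)$ constant independent of $n$ and $\rho$.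
   Context: Ordinal MSP: elements arrive in uniformly random order; the algorithm can only compare revealed elements under $\succ$ and must decide irrevocably on each arrival, keeping the selected set independent. $\mathrm{OPT}$ is the set of the $\rho$ highest elements. An algorithm is $\alpha$ probability-competitive if $\Pr(e\in\mathrm{ALG})\ge1/\alpha$ for every $e\in\mathrm{OPT}$.
   Formalization: Stated for ρ ≥ 96: for smaller ρ no ε_j is prescribed, and with huge ε_j the claim fails as n grows. If fewer elements than the requested rank have arrived in I_{j+1}, f_j is taken to lie below every element. *)

(* Defs.v *)
From HB Require Import structures.
From mathcomp Require Import all_boot all_order all_algebra.
From mathcomp Require Import all_classical all_reals all_analysis.
Set Implicit Arguments.
Unset Strict Implicit.
Unset Printing Implicit Defensive.
Import Order.TTheory GRing.Theory Num.Theory.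
Local Open Scope classical_set_scope.
Local Open Scope ring_scope.

Section Algorithm.
Context {R : realType} {disp : Order.disp_t} {E : finOrderType disp}.

(* The order of E is the preference order: e < x means that x is better. *)
Definition OPT (rho : nat) : {set E} :=
  [set e | (#|[set x : E | (e < x)%O]| < rho)%N]%SET.

(* None when S has fewer than k elements (or k = 0). *)
Definition kth_highest (k : nat) (S : {set E}) : option E :=
  [pick e in S | #|[set x in S | (e <= x)%O]%SET| == k].

(* A missing threshold is below every element. *)
Definition above (x : E) (f : option E) : bool :=
  if f is Some y then (y < x)%O else true.

Definition I_ (j : nat) : interval R := `[0, 2 ^- j[.
Definition J_ (j : nat) : interval R := `[2 ^- j.+1, 2 ^- j[.

Section Run.
Context {n : nat}.
Variables (rho : nat) (eps : nat -> R).
(* tnth t i is the i-th smallest time, r i the i-th element to arrive. *)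
Variables (t : n.-tuple R) (r : {ffun 'I_n -> E}).

(* Elements of {r_0, ..., r_i} whose arrival time lies in I_(j+1). *)
Definition sampled (i : 'I_n) (j : nat) : {set E} :=
  [set r k | k : 'I_n & (k <= i)%N && (tnth t k \in I_ j.+1)]%SET.

Definition threshold (i : 'I_n) (j : nat) : option E :=
  kth_highest `|Num.ceil (2 ^- j.+1 * (1 + eps j) * rho%:R)|%N (sampled i j).

Definition selected_in (A : {set E}) (j : nat) : {set E} :=
  [set r k | k : 'I_n & (tnth t k \in J_ j) && (r k \in A)]%SET.

(* The J_j are disjoint and cover ]0, 1[, so j is unique, and exists unless
   the arrival time is 0, a null event, in which case r i is discarded. *)
Definition accepts (A : {set E}) (i : 'I_n) : bool :=
  `[< exists j : nat,
      [/\ tnth t i \in J_ j,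
          #|selected_in A j|%:R < 2 ^- j.+1 * rho%:R :> R
        & above (r i) (threshold i j)] >].

Definition ALG : {set E} :=
  foldl (fun A i => if accepts A i then (r i |: A)%SET else A)
        finset.set0 (enum 'I_n).

End Run.
End Algorithm.

Section Model.
Context {d : measure_display} {T : measurableType d} {R : realType}.
Variable P : probability T R.

(* The law of U i on [0, 1[ and on [0, 1] is the same. *)
Definition uniform_times {n : nat} (U : 'I_n -> {RV P >-> R}) : Prop :=
  forall (i : 'I_n) (A : set R), measurable A ->
    distribution P (U i) A = uniform_prob (@ltr01 R) A.

(* With #|E| = n, r is a uniformly random enumeration of E. *)
Definition uniform_order {n : nat} {E : finType}
    (r : T -> {ffun 'I_n -> E}) : Prop :=
  (forall w, injective (r w)) /\
  forall s : {ffun 'I_n -> E}, injective s ->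
    measurable (r @^-1` [set s]) /\
    P (r @^-1` [set s]) = ((n`!)%:R^-1)%:E.

(* Mutual independence of the n + 1 random elements r, U_0, ..., U_(n-1); the
   product rule for subfamilies is obtained with full events. *)
Definition independent_order_times {n : nat} {E : finType}
    (r : T -> {ffun 'I_n -> E}) (U : 'I_n -> {RV P >-> R}) : Prop :=
  forall (S : set {ffun 'I_n -> E}) (A : 'I_n -> set R),
    (forall i, measurable (A i)) ->
    P ((r @^-1` S) `&` [set w | forall i, A i (U i w)]) =
    (P (r @^-1` S) * \prod_(i < n) P (U i @^-1` A i))%E.

Definition sorted_times {n : nat} (U : 'I_n -> {RV P >-> R}) (w : T) :
    n.-tuple R :=
  [tuple of sort <=%R [tuple U i w | i < n]].

Definition prob_competitive {disp : Order.disp_t} {E : finOrderType disp}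
    (rho : nat) (alpha : R) (alg : T -> {set E}) : Prop :=
  forall e : E, e \in OPT rho -> (alpha^-1%:E <= P [set w | e \in alg w])%E.

End Model.

(* The prescribed values of eps_j; eps_j is any nonnegative real for larger j. *)
Definition eps_spec {R : realType} (rho : nat) (eps : nat -> R) : Prop :=
  (forall j, 0 <= eps j) /\
  forall j : nat,
    (j%:Z <= Num.floor (2^-1 * (ln (rho%:R / 96) / ln 2) : R)) ->
    eps j = Num.sqrt (12 * 2 ^+ j * ln rho%:R / rho%:R).

(* Main.v *)
(** Give every element e the time tau(e) at which it arrives; these times are
    independent and uniform.  Fix e in OPT and put p = 2^-(j+1), where 4^j <= rho / 96.
    With w = p / ((1 + 5 eps_j) (1 + 3 eps_j)), the element e is selected as soon as
    tau(e) lies in the window [p, p + w) and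
    - fewer elements above e than the rank of f_j arrive before p, so e beats f_j;
    - enough of the top (1 + 4 eps_j) rho elements arrive before p, so that
      everything selected in J_j is among these;
    - fewer than p rho of these, other than e, arrive in the window, so that the
      capacity of J_j is not exhausted when e arrives.
    By Chernoff bounds each of the last three conditions fails with probability
    at most rho^(-1/2), independently of tau(e).  Summing w (1 - 3 rho^(-1/2)) over j
    yields 1 - O(sqrt (ln rho / rho)), the windows being disjoint. *)

Require Import Defs.
From HB Require Import structures.
From mathcomp Require Import all_boot all_order all_algebra.
From mathcomp Require Import all_classical all_reals all_analysis.
From mathcomp Require Import fingroup perm ring lra zify.
Set Implicit Arguments.
Unset Strict Implicit.
Unset Printing Implicit Defensive.
Import Order.TTheory GRing.Theory Num.Theory.
Local Open Scope classical_set_scope.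
Local Open Scope ring_scope.

(** * Chernoff bounds over subsets *)

(** Distributivity: the product of [f + g] over [S] is extended to all of [E] by factors [0 + 1],
    which kill every subset not contained in [S]. *)
Lemma sum_subsets (R : comNzRingType) (E : finType) (S : {set E}) (f g : R) :
  \sum_(Q : {set E} | Q \subset S) \prod_(x in S) (if x \in Q then f else g) =
  (f + g) ^+ #|S|.
Proof.
rewrite -prodr_const.
transitivity (\prod_x ((if x \in S then f else 0) + (if x \in S then g else 1))).
  rewrite [RHS]bigA_distr [RHS](bigID [pred Q : {set E} | Q \subset S]) /=.
  rewrite [X in _ = _ + X]big1 ?addr0 => [|Q /fintype.subsetPn[x xQ xS]].
    apply: eq_bigr => Q QS; rewrite big_mkcond /=; apply: eq_bigr => x _.
    case: ifPn => xS; first by case: ifP.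
    by rewrite ifF//; apply/negbTE; apply: contra xS; exact: (fintype.subsetP QS).
  by rewrite (bigD1 x)//= xQ (negbTE xS) mul0r.
rewrite [RHS]big_mkcond; apply: eq_bigr => x _.
by case: ifP => //; rewrite add0r.
Qed.

Section Numerics.
Context {R : realType}.
Implicit Types (x a e L : R).

Lemma expR_le_sub1V x : x < 1 -> expR x <= (1 - x)^-1.
Proof.
move=> x1; rewrite -[x]opprK expRN opprK lef_pV2 ?posrE ?expR_gt0 ?subr_gt0//.
exact: expR_ge1Dx.
Qed.

Lemma expR_le_quad_pos x : 0 <= x <= 2^-1 -> expR x <= 1 + x + 2 * x ^+ 2.
Proof.
move=> /andP[x0 x1]; apply: le_trans (expR_le_sub1V _) _; first by lra.
rewrite -div1r ler_pdivrMr; last by lra.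
nra.
Qed.

Lemma expR_le_quad_neg x : x <= 0 -> expR x <= 1 + x + x ^+ 2.
Proof.
move=> x0; apply: le_trans (expR_le_sub1V _) _; first by lra.
rewrite -div1r ler_pdivrMr; last by lra.
nra.
Qed.

(** Exponential Markov inequality for the random subset of [S] that contains each element
    independently with probability [b]. Each [Q] in [D] is weighted by [expR (l * (#|Q| - a)) >= 1],
    the total is computed by [sum_subsets], and [b * expR l + 1 - b <= expR (b * (expR l - 1))]. A
    positive [l] serves upper tails, a negative one lower tails. *)
Lemma chernoff_subsets (E : finType) (S : {set E}) (D : pred {set E}) (b l a : R) :
  0 <= b <= 1 ->
  (forall Q : {set E}, Q \subset S -> D Q -> l * a <= l * #|Q|%:R) ->
  \sum_(Q : {set E} | (Q \subset S) && D Q)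
      \prod_(x in S) (if x \in Q then b else 1 - b) <=
  expR (- l * a + #|S|%:R * b * (expR l - 1)).
Proof.
move=> /andP[b0 b1] la.
apply: (@le_trans _ _ (expR (- l * a) * (b * expR l + (1 - b)) ^+ #|S|)); last first.
  rewrite expRD ler_wpM2l ?expR_ge0// -mulrA [_ * (b * _)]mulrC expRM_natr.
  rewrite lerXn2r ?nnegrE ?expR_ge0//.
    by rewrite addr_ge0 ?mulr_ge0 ?expR_ge0//; lra.
  by apply: le_trans (expR_ge1Dx _); lra.
rewrite -sum_subsets mulr_sumr big_mkcondr /=; apply: ler_sum => Q QS.
have pr_ge0 c : 0 <= c -> 0 <= \prod_(x in S) (if x \in Q then c else 1 - b).
  by move=> c0; apply: prodr_ge0 => x _; case: ifP => // _; lra.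
case: ifPn => DQ; last by rewrite mulr_ge0 ?expR_ge0// pr_ge0// mulr_ge0 ?expR_ge0.
have -> : \prod_(x in S) (if x \in Q then b * expR l else 1 - b) =
    expR (l * #|Q|%:R) * \prod_(x in S) (if x \in Q then b else 1 - b).
  rewrite expRM_natr -prodr_const (big_mkcond (fun y : E => y \in Q)) /=.
  rewrite (big_mkcond (fun y : E => y \in S)) /= (big_mkcond (fun y : E => y \in S)) /=.
  rewrite -big_split /=; apply: eq_bigr => x _.
  case: ifPn => xS; first by case: ifP; rewrite ?mul1r// mulrC.
  by rewrite ifF ?mul1r//; apply/negbTE; apply: contra xS; exact: (fintype.subsetP QS).
rewrite mulrA -expRD ler_peMl// ?pr_ge0// -[X in X <= _]expR0 ler_expR mulNr addrC subr_ge0.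
exact: la.
Qed.

(* Here [a = p * rho], [e = eps_j] and [L = ln rho], so that [e ^+ 2 * a = 6 * L]. *)
Lemma exponent_upper a e L : 0 <= a -> 0 <= e <= 2 -> e ^+ 2 * a = 6 * L ->
  - (e / 4) * ((1 + e) * a) + a * (expR (e / 4) - 1) <= - (2^-1 * L).
Proof.
move=> a0 e02 eL; have h : expR (e / 4) <= 1 + e / 4 + 2 * (e / 4) ^+ 2.
  by apply: expR_le_quad_pos; lra.
have := ler_wpM2l a0 h; nra.
Qed.

(** Lower tail of a binomial of mean [(1 + 4 * e) * a] at [(1 + e) * a]. The linear terms contribute
    [- e ^+ 2 * a / 2], and the quadratic one at most half of that, because [1 + 4 * e <= 9]. *)
Lemma exponent_lower a e L : 0 <= a -> 0 <= e <= 2 -> e ^+ 2 * a = 6 * L ->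
  - (- (e / 6)) * ((1 + e) * a) + (1 + 4 * e) * a * (expR (- (e / 6)) - 1)
     <= - (2^-1 * L).
Proof.
move=> a0 e02 eL.
have h : expR (- (e / 6)) <= 1 + - (e / 6) + (- (e / 6)) ^+ 2.
  by apply: expR_le_quad_neg; lra.
have a1 : 0 <= (1 + 4 * e) * a by apply: mulr_ge0 => //; lra.
have := ler_wpM2l a1 h.
have : e ^+ 2 * a * (1 + 4 * e) <= e ^+ 2 * a * 9.
  by rewrite ler_wpM2l//; [rewrite mulr_ge0// exprn_ge0|]; lra.
nra.
Qed.

(** Upper tail of a binomial of mean [m = a / (1 + 3 * e)] at [a]. The exponent is at most
    [- 5 / 8 * e ^+ 2 * m] with [m >= a / 7], that is [- 15 / 28 * L]: the tightest of the three
    tails. *)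
Lemma exponent_window a e L : 0 <= a -> 0 <= e <= 2 -> e ^+ 2 * a = 6 * L ->
  - (e / 4) * a + a / (1 + 3 * e) * (expR (e / 4) - 1) <= - (2^-1 * L).
Proof.
move=> a0 e02 eL; set m := a / _.
have aE : a = m * (1 + 3 * e) by rewrite mulfVK//; lra.
have m0 : 0 <= m by rewrite divr_ge0//; lra.
have h : expR (e / 4) <= 1 + e / 4 + 2 * (e / 4) ^+ 2.
  by apply: expR_le_quad_pos; lra.
have := ler_wpM2l m0 h.
have : e ^+ 2 * m * (1 + 3 * e) <= e ^+ 2 * m * 7.
  by rewrite ler_wpM2l//; [rewrite mulr_ge0// exprn_ge0|]; lra.
rewrite aE in eL *; nra.
Qed.
End Numerics.

(** * A sufficient condition for being accepted *)

Lemma J_disjoint (R : realType) j j' (x : R) : x \in J_ j -> x \in J_ j' -> j = j'.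
Proof.
wlog jj' : j j' / (j <= j')%N.
  move=> h; case: (leqP j j') => [|/ltnW] jj' xj xj'; first exact: h.
  by apply/esym/h.
rewrite leq_eqVlt in jj'; case/predU1P: jj' => [//|jj'].
rewrite !in_itv/= => /andP[h _] /andP[_ h']; move: (le_lt_trans h h').
rewrite ltf_pV2 ?posrE ?exprn_gt0// ltNge ler_weXn2l//.
by rewrite ler1n.
Qed.

Lemma I_J_lt (R : realType) j (x y : R) : x \in I_ j.+1 -> y \in J_ j -> x < y.
Proof. by rewrite !in_itv/= => /andP[_ h] /andP[h' _]; apply: lt_le_trans h'. Qed.

(** Induction on the size of [S]: its least element has rank [#|S|], and removing it changes no
    other rank. *)
Lemma kth_highest_exists {disp} {E : finOrderType disp} k (S : {set E}) :
  (0 < k <= #|S|)%N -> exists2 y, y \in S &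
   kth_highest k S = Some y /\ #|[set x in S | (y <= x)%O]%SET| = k.
Proof.
move=> kS; suff [y [yS yk]] : exists y, y \in S /\ #|[set x in S | (y <= x)%O]%SET| = k.
  rewrite /kth_highest; case: pickP => [z /andP[zS /eqP zk]|/(_ y)].
    by exists z.
  by rewrite yS yk eqxx.
move: kS; move sS : #|S| => s.
elim: s S sS => [|s IH] S sS; first by rewrite leqn0; case: k.
case/andP=> k0; rewrite leq_eqVlt => kS.
have /set0Pn[x0 x0S] : S != finset.set0 by rewrite -card_gt0 sS.
case: (Order.TotalTheory.arg_minP id x0S) => y yS ymin.
have {}yS : y \in S by exact: yS.
case/predU1P: kS => [->|kS].
  exists y; split=> //; rewrite -sS; apply: eq_card => x; rewrite inE.
  by case xS: (x \in S) => //=; apply: ymin.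
have sS' : #|S :\ y| = s by move: (cardsD1 y S); rewrite yS sS; lia.
have [|z [zS zk]] := IH _ sS'; first by rewrite k0.
move: zS; rewrite inE => /andP[/[!inE] zy zS].
exists z; split=> //; rewrite -zk; apply: eq_card => x; rewrite !inE.
case: (eqVneq x y) => [->|//]; rewrite andbC /=.
by apply/negbTE; rewrite negb_and -ltNge lt_neqAle eq_sym zy ymin.
Qed.

Section Deterministic.
Context {R : realType} {disp : Order.disp_t} {E : finOrderType disp}.
Context {n : nat}.
Variables (rho : nat) (eps : nat -> R).
Variables (t : n.-tuple R) (r : {ffun 'I_n -> E}).

Definition arrival (x : E) : R :=
  if [pick i | r i == x] is Some i then tnth t i else 0.

Hypothesis rI : injective r.

Lemma arrivalE i : arrival (r i) = tnth t i.
Proof.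
rewrite /arrival; case: pickP => [k /eqP/rI ->//|/(_ i)]; by rewrite eqxx.
Qed.

Hypothesis cardE : #|E| = n.

Lemma arrival_order_surj x : exists i, r i = x.
Proof.
have /(_ x) : r @: [set: 'I_n]%SET =i [set: E]%SET.
  apply/subset_cardP; last by apply/fintype.subsetP => y; rewrite inE.
  by rewrite card_imset// !cardsT card_ord cardE.
by rewrite inE => /imsetP[i _ ->]; exists i.
Qed.

Hypothesis t_sorted : sorted <=%R t.

Lemma tnth_sorted (i k : 'I_n) : (i <= k)%N -> tnth t i <= tnth t k.
Proof.
move=> ik; rewrite !(tnth_nth 0); apply: sorted_leq_nth => //.
- exact: le_trans.
- by rewrite inE size_tuple.
- by rewrite inE size_tuple.
Qed.

Definition sample (j : nat) : {set E} := [set x | arrival x \in I_ j.+1]%SET.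
Definition quota (j : nat) : nat :=
  `|Num.ceil (2 ^- j.+1 * (1 + eps j) * rho%:R)|%N.

(** Everything arriving in [I_ j.+1] precedes everything arriving in [J_ j], so the sample is
    complete when [r i] arrives, and all arrivals in [J_ j] face the same threshold. *)
Lemma thresholdE i j : tnth t i \in J_ j ->
  threshold rho eps t r i j = kth_highest (quota j) (sample j).
Proof.
move=> tij; rewrite /threshold; congr kth_highest.
apply/setP => x; rewrite inE; apply/imsetP/idP => [[k /[!inE]/andP[_ tk] ->]|].
  by rewrite arrivalE.
have [k <-] := arrival_order_surj x; rewrite arrivalE => tk; exists k => //.
rewrite inE tk andbT leqNgt; apply/negP => ik.
have := I_J_lt tk tij; rewrite ltNge => /negP; apply; apply: tnth_sorted.
exact: ltnW.
Qed.

Let step A i := if accepts rho eps t r A i then (r i |: A)%SET else A.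

Lemma foldl_step_sub (A : {set E}) s : A \subset foldl step A s.
Proof.
elim: s A => [|i s IH] A //=; apply: fintype.subset_trans (IH _).
by rewrite /step; case: ifP => // _; apply: finset.subsetUr.
Qed.

(** Of the acceptance test only the threshold part is retained; it serves to locate the earlier
    selections within the top of the order. *)
Lemma foldl_step_inv s x : x \in foldl step finset.set0 s ->
  exists2 k, k \in s & x = r k /\ forall j, tnth t k \in J_ j ->
    above x (kth_highest (quota j) (sample j)).
Proof.
elim/last_ind: s => [|s i IH]; first by rewrite /= inE.
rewrite foldl_rcons {1}/step; case: ifP => [/asboolP[j [tij _ ab]]|_].
  rewrite 2!inE => /predU1P[->|/IH[k ks h]].
    exists i; first by rewrite mem_rcons mem_head.
    by split=> // j' /(J_disjoint tij) <-; rewrite -(thresholdE tij).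
  by exists k => //; rewrite mem_rcons in_cons ks orbT.
by move=> /IH[k ks h]; exists k => //; rewrite mem_rcons in_cons ks orbT.
Qed.

Lemma enum_ord_split (i : 'I_n) : exists s1 s2, enum 'I_n = s1 ++ i :: s2 /\
  forall k, k \in s1 -> (k < i)%N.
Proof.
have /splitPr : i \in enum 'I_n by rewrite mem_enum.
have : sorted (fun i k : 'I_n => (i < k)%N) (enum 'I_n).
  rewrite -[sorted _ _]/(sorted (relpre val ltn) (enum _)) -path.sorted_map.
  by rewrite val_enum_ord iota_ltn_sorted.
rewrite sorted_pairwise; last by move=> x y z; apply: ltn_trans.
move=> + es; case: es => s1 s2; rewrite pairwise_cat => /and3P[/allrelP h _ _].
by exists s1, s2; split=> // k ks; apply: h => //; rewrite mem_head.
Qed.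

(** If [top] is well sampled, the threshold is so high that only elements of [top] can have been
    selected in [J_ j]. Those selected before [e] are then among the few counted in the last
    hypothesis, so capacity remains. The alternative [top = setT] covers ground sets too small to
    supply the sample. *)
Lemma mem_ALG j e (top : {set E}) :
  arrival e \in J_ j ->
  (#|[set x in sample j | (e < x)%O]%SET| < quota j)%N ->
  e \in top -> (forall x y, x \in top -> (x < y)%O -> y \in top) ->
  (0 < quota j)%N ->
  top = [set: E]%SET \/ (quota j <= #|top :&: sample j|)%N ->
  #|[set x in top :\ e | (arrival x \in J_ j) && (arrival x <= arrival e)]%SET|%:R
     < 2 ^- j.+1 * rho%:R :> R ->
  e \in ALG rho eps t r.
Proof.
have [i <-] := arrival_order_surj e; rewrite arrivalE.
move=> tij eq_quota etop upc quota_gt0 topP few.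
have [s1 [s2 [es s1i]]] := enum_ord_split i.
rewrite /ALG es foldl_cat -/step /=; set A := foldl _ _ s1.
have acc : accepts rho eps t r A i.
  apply/asboolP; exists j; split=> //.
    apply: le_lt_trans few; rewrite ler_nat; apply/subset_leq_card.
    apply/fintype.subsetP => x /imsetP[k /[!finset.in_set] /andP[tkj]].
    move=> /foldl_step_inv[k' k's1 [rkk' ab]] ->.
    have {k' rkk' k's1 ab} [ks1 ab] : k \in s1 /\ forall j : nat, tnth t k \in J_ j ->
        above (r k) (kth_highest (quota j) (sample j)).
      by rewrite (rI rkk'); split=> // j0; rewrite -rkk'; apply: ab.
    have ki := s1i _ ks1.
    rewrite finset.in_set1 arrivalE tkj tnth_sorted 1?ltnW// !andbT.
    rewrite (inj_eq rI) neq_ltn ki/=.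
    case: topP => [->|topP]; first by rewrite inE.
    have [|y yS [ky yq]] := @kth_highest_exists _ _ (quota j) (sample j).
      by rewrite quota_gt0 (leq_trans topP)// subset_leq_card// finset.subsetIr.
    move: (ab j tkj); rewrite ky /= => yrk.
    case: (boolP (r k \in top)) => // rktop.
    (* If [r k] were outside [top], so would be the lower [y]; then all sampled elements of [top]
       lie above [y], and with [y] itself its rank exceeds the quota. *)
    suff: (quota j < quota j)%N by rewrite ltnn.
    have ytop : y \notin top by apply: contra rktop => /upc/(_ yrk).
    rewrite -{2}yq; apply: leq_ltn_trans topP _.
    apply: proper_card; apply/properP; split.
      apply/fintype.subsetP => z; rewrite !inE => /andP[ztop ->] /=.
      rewrite leNgt; apply: contra ytop; exact: upc.
    by exists y; rewrite !inE ?lexx ?(negbTE ytop)// andbT; move: yS; rewrite inE.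
  (* A missing threshold is passed trivially. A threshold not below [e] would put a full quota of
     sampled elements strictly above [e], which is itself not sampled. *)
  rewrite thresholdE//; case kh: kth_highest => [y|]//=.
  move: kh; rewrite /kth_highest; case: pickP => // z /andP[zS /eqP zq] [<-{y}].
  rewrite ltNge; apply/negP => iz; move: eq_quota; rewrite ltnNge => /negP; apply.
  rewrite -zq; apply/subset_leq_card/fintype.subsetP => x; rewrite !inE.
  move=> /andP[xS zx]; rewrite xS/= lt_neqAle (le_trans iz zx) andbT.
  apply/eqP => rix; move: xS; rewrite -rix arrivalE => /I_J_lt /(_ tij).
  by rewrite ltxx.
apply: (fintype.subsetP (foldl_step_sub _ _)).
by rewrite {1}/step acc !inE eqxx.
Qed.
End Deterministic.

(** * The law of the arrival times *)

Section Measurability.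
Context {d : measure_display} {T : measurableType d}.

(** Such a [Q] is a finite union of atoms of the algebra generated by the tests [b k], one atom for
    each pattern of outcomes. *)
Lemma measurable_determined (K : finType) (b : K -> T -> bool) (Q : T -> Prop) :
  (forall k, measurable [set w | b k w]) ->
  (forall w w', (forall k, b k w = b k w') -> Q w -> Q w') ->
  measurable [set w | Q w].
Proof.
move=> mb bQ.
pose pat w := [ffun k => b k w].
have -> : [set w | Q w] = \bigcup_(a in pat @` [set w | Q w]) \bigcap_(k in [set: K])
    [set w | b k w = a k].
  apply/seteqP; split=> [w Qw|w [_ [w' Qw' <-] /= ww']].
    by exists (pat w) => [|k _ /=]; [exists w | rewrite ffunE].
  by apply: bQ Qw' => k; have /= := ww' k I; rewrite ffunE.
apply: fin_bigcup_measurable => [|a _]; first exact: finite_finset.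
apply: fin_bigcap_measurable => [|k _]; first exact: finite_finset.
case: (a k); first exact: mb.
rewrite [X in measurable X](_ : _ = ~` [set w | b k w]); first exact/measurableC/mb.
by apply/seteqP; split=> w /=; [move=> -> | move/negP/negbTE].
Qed.

Context {R : realType}.

Lemma measurable_preimage_itv (f : T -> R) (i : interval R) :
  measurable_fun setT f -> measurable [set w | f w \in i].
Proof.
move=> mf; rewrite -[X in measurable X]setTI.
apply: (mf measurableT [set x | x \in i]); exact: measurable_itv.
Qed.

(** The order statistic of index [i] is below [x] exactly when more than [i] of the values are,
    which depends only on finitely many comparisons. *)
Lemma measurable_sort n (u : 'I_n -> T -> R) (i : 'I_n) :
  (forall k, measurable_fun setT (u k)) ->
  measurable_fun setT
    (fun w => tnth [tuple of sort <=%R [tuple u k w | k < n]] i).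
Proof.
move=> mu; apply: (measurability _ (measurable_realfun.RGenInftyO.measurableE R)) => //.
move=> /= _ [_ [x ->] <-]; rewrite setTI.
pose c w := count (fun k => u k w < x) (enum 'I_n).
rewrite [X in measurable X](_ : _ = [set w | (i < c w)%N]); last first.
  apply/seteqP; suff h w : (tnth [tuple of sort <=%R [tuple u k w | k < n]] i < x)
      = (i < c w)%N.
    by split=> w /=; rewrite in_itv /= h.
  rewrite (tnth_nth 0) /=; set s := sort _ _.
  have ss : sorted <=%R s by apply: sort_le_sorted.
  have sc : c w = count (< x) s.
    by rewrite /s (seq.permP (permEl (perm_sort _ _))) /= count_map.
  have sz : size s = n by rewrite size_sort size_map size_enum_ord.
  rewrite sc; apply/idP/idP; last by move=> h; apply: nth_count_lt.
  apply: contraTT; rewrite -leqNgt -leNgt => h; apply: nth_count_ge => //.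
  by rewrite sz h ltn_ord.
apply: (measurable_determined (b := fun k w => u k w < x)) => [k|w w' ww'].
  by have := measurable_preimage_itv `]-oo, x[ (mu k);
    rewrite (_ : [set w | _] = [set w | u k w < x]).
by rewrite /c; under eq_count do rewrite ww'.
Qed.

Context {disp : Order.disp_t} {E : finOrderType disp}.
Variables (n rho : nat) (eps : nat -> R) (t : T -> n.-tuple R).
Hypothesis mt : forall i, measurable_fun setT (fun w => tnth (t w) i).

Lemma measurable_accepts (r : {ffun 'I_n -> E}) A i :
  measurable [set w | accepts rho eps (t w) r A i].
Proof.
rewrite [X in measurable X](_ : _ = \bigcup_j
    ([set w | tnth (t w) i \in J_ j] `&`
     ([set w | #|selected_in (t w) r A j|%:R < 2 ^- j.+1 * rho%:R :> R] `&`
      [set w | above (r i) (threshold rho eps (t w) r i j)]))); last first.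
  apply/seteqP; split=> w /=.
    by move/asboolP=> [j [? ? ?]]; exists j.
  by move=> [j _ [? [? ?]]]; apply/asboolP; exists j.
apply: bigcup_measurable => j _; apply: measurableI;
  first exact: measurable_preimage_itv.
apply: measurableI.
  apply: (measurable_determined (b := fun k w => tnth (t w) k \in J_ j)) => [k|w w' ww'].
    exact: measurable_preimage_itv.
  suff -> : selected_in (t w) r A j = selected_in (t w') r A j by [].
  rewrite /selected_in; congr (@finset.imset _ _ _ (mem (pred_of_set _)));
  apply/finset.setP => k.
  by rewrite !finset.in_set ww'.
apply: (measurable_determined (b := fun k w => tnth (t w) k \in I_ j.+1)) => [k|w w' ww'].
  exact: measurable_preimage_itv.
suff -> : threshold rho eps (t w) r i j = threshold rho eps (t w') r i j by [].
rewrite /threshold; congr kth_highest.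
rewrite /sampled; congr (@finset.imset _ _ _ (mem (pred_of_set _)));
  apply/finset.setP => k.
by rewrite !finset.in_set ww'.
Qed.

Lemma measurable_mem_ALG (r : {ffun 'I_n -> E}) e :
  measurable [set w | e \in ALG rho eps (t w) r].
Proof.
rewrite /ALG; move: (enum 'I_n) finset.set0; elim=> [|i s IH] A /=.
  case: (e \in A); last by rewrite (_ : [set w | _] = set0)// seteqP; split.
  by rewrite (_ : [set w | _] = setT)// seteqP; split.
have mA := measurable_accepts r A i.
rewrite [X in measurable X](_ : _ =
  ([set w | accepts rho eps (t w) r A i] `&` [set w | e \in foldl
     (fun A i => if accepts rho eps (t w) r A i then (r i |: A)%SET else A)
     (r i |: A)%SET s]) `|`
  (~` [set w | accepts rho eps (t w) r A i] `&` [set w | e \in foldl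
     (fun A i => if accepts rho eps (t w) r A i then (r i |: A)%SET else A) A s])).
  apply: measurableU; apply: measurableI => //; do ?[exact: IH | exact: measurableC].
apply/seteqP; split=> w /=; case: ifPn => h.
- by left.
- by right; split=> //; apply/negP.
- by case=> [[]|[]].
- by case=> [[]|[]].
Qed.

End Measurability.
(** Integrating the pointwise identity turns a counting identity into one between probabilities. *)
Lemma sum_measure_indic d (T : measurableType d) (R : realType)
  (P : probability T R) (I J : finType) (Q : pred I) (Q' : pred J)
  (F : I -> set T) (F' : J -> set T) :
  (forall i, measurable (F i)) -> (forall j, measurable (F' j)) ->
  (forall w, \sum_(i | Q i) \1_(F i) w = \sum_(j | Q' j) \1_(F' j) w :> R) ->
  (\sum_(i | Q i) P (F i) = \sum_(j | Q' j) P (F' j))%E.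
Proof.
have sumE (K : finType) (B : pred K) (H : K -> set T) : (forall k, measurable (H k)) ->
    (\sum_(k | B k) P (H k) = \int[P]_w ((\sum_(k | B k) \1_(H k) w)%:E))%E.
  move=> mH; under eq_integral do rewrite -sumEFin -big_filter.
  rewrite ge0_integral_sum//; last first.
    by move=> k;
      apply/measurable_realfun.measurable_EFinP/measurable_realfun.measurable_indic.
  rewrite -big_filter; apply: eq_bigr => k _.
  by rewrite integral_indic// setIT.
by move=> mF mF' FF'; rewrite !sumE//; apply: eq_integral => w _; rewrite FF'.
Qed.

Section Law.
Context {d : measure_display} {T : measurableType d} {R : realType}.
Variable P : probability T R.
Context {n : nat} {E : finType}.
Variables (U : 'I_n -> {RV P >-> R}) (r : T -> {ffun 'I_n -> E}).
Hypotheses (uU : uniform_times U) (ur : uniform_order P r)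
  (ind : independent_order_times r U).
Hypothesis cardE : #|E| = n.

(** The rectangles in the unsorted times: the pi-system of the Dynkin argument. *)
Let G : set (set T) := [set V | exists A : 'I_n -> set R,
  (forall i, measurable (A i)) /\ V = [set w | forall i, A i (U i w)]].

Lemma measurable_all_times (A : 'I_n -> set R) : (forall i, measurable (A i)) ->
  measurable [set w | forall i, A i (U i w)].
Proof.
move=> mA; rewrite [X in measurable X](_ : _ = \bigcap_(i in setT) (U i @^-1` A i)).
  apply: fin_bigcap_measurable => [|i _]; first exact: finite_finset.
  by rewrite -[X in measurable X]setTI; apply: measurable_funP.
by apply/seteqP; split=> w h i; [move=> _; exact: h | exact: (h i I)].
Qed.

(* The hypothesis only covers rectangles in the times; sorting leads to other
   events, which are reached by a Dynkin argument. *)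
Lemma order_indep_times (s : {ffun 'I_n -> E}) (V : set T) :
  injective s -> <<s G >> V ->
  measurable V /\ P (r @^-1` [set s] `&` V) = (P (r @^-1` [set s]) * P V)%E.
Proof.
move=> sI sGV; have [mS _] := ur.2 s sI; set S := r @^-1` _ in mS *.
have GV : G `<=` measurable by move=> _ [A [mA ->]]; exact: measurable_all_times.
have sGm : <<s G >> `<=` measurable by apply: smallest_sub => //;
  exact: sigma_algebra_measurable.
split; first exact: sGm.
have Pfin W : measurable W -> P W \is a fin_num by exact: fin_num_measure.
apply: (@dynkin_induction _ (g_sigma_algebraType G) G
  (fun V => P (S `&` V) = (P S * P V)%E)) sGV => //.
- move=> _ _ [A [mA ->]] [B [mB ->]]; exists (fun i => A i `&` B i); split.
    by move=> i; exact: measurableI.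
  by apply/seteqP; split=> w /= => [[h1 h2] i|h]; [split | split=> i; have [] := h i].
- by rewrite setIT probability_setT mule1.
- move=> _ [A [mA ->]]; rewrite ind//.
  have := ind setT mA; rewrite preimage_setT setTI probability_setT mul1e => ->.
  by [].
- move=> W /sGm mW PW; rewrite -setDE measureD//; last by rewrite ltey_eq Pfin.
  transitivity (P S - P S * P W)%E; first by congr (_ - _)%E; exact: PW.
  by rewrite probability_setC// muleBr ?mule1 ?Pfin//.
- move=> F0; pose F : nat -> set T := F0; rewrite -[F0]/F => mF0 tF PF.
  have mF k : d.-measurable (F k) by apply: sGm; exact: (mF0 k).
  rewrite setI_bigcupr.
  rewrite !measure_bigcup//=; last 2 first.
    by move=> k _; exact: measurableI.
    exact: trivIset_setIl.
  rewrite -(fineK (Pfin _ mS)) -nneseriesZl//.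
  by apply: eq_eseriesr => k _; rewrite fineK ?Pfin//; exact: PF.
Qed.

(** Order statistics are measurable for the sigma-algebra generated by the unsorted times, so
    [measurable_sort] is applied with that sigma-algebra instead of the ambient one. *)
Lemma measurable_all_sorted (A : 'I_n -> set R) : (forall i, measurable (A i)) ->
  <<s G >> [set w | forall i, A i (tnth (sorted_times U w) i)].
Proof.
move=> mA; rewrite [X in <<s _ >> X](_ : _ =
   \bigcap_(i in setT) ((fun w => tnth (sorted_times U w) i) @^-1` A i)); last first.
  by apply/seteqP; split=> w h i; [move=> _; exact: h | exact: (h i I)].
apply: (@fin_bigcap_measurable _ (g_sigma_algebraType G)) => [|i _].
  exact: finite_finset.
rewrite -[X in _.-measurable X]setTI;
  apply: (@measurable_sort _ (g_sigma_algebraType G) R n U i) => //.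
move=> k _ B mB; rewrite setTI; apply: sub_sigma_algebra.
exists (fun i => if i == k then B else setT); split=> [j|]; first by case: ifP.
apply/seteqP; split=> w /= => [Bw j|/(_ k)]; last by rewrite eqxx.
by case: eqP => [->|].
Qed.

(* The permutation that sorts the times also acts on the enumerations of E; ties
   are harmless because only the existence of such a permutation is used. *)
Lemma sum_sorted_times (A : E -> set R) w :
  \sum_(s : {ffun 'I_n -> E} | injectiveb s)
     \1_[set w | forall i, A (s i) (tnth (sorted_times U w) i)] w =
   \sum_(s : {ffun 'I_n -> E} | injectiveb s)
     \1_[set w | forall i, A (s i) (U i w)] w :> R.
Proof.
have : perm_eq (sorted_times U w) [tuple U i w | i < n] by rewrite /= perm_sort.
move=> /tuple_permP[p tp].
have tpi i : tnth (sorted_times U w) i = U (p i) w.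
  rewrite (tnth_nth 0) tp -tnth_nth !tnth_mktuple //.
pose h (s : {ffun 'I_n -> E}) : {ffun 'I_n -> E} := [ffun i => s (p i)].
have hI : bijective h.
  exists (fun s : {ffun 'I_n -> E} => [ffun i => s ((p^-1)%g i)]) => s;
  by apply/ffunP => i; rewrite !ffunE ?permK ?permKV.
rewrite (reindex h) /=; last exact: onW_bij.
apply: eq_big => [s|s _].
  apply/injectiveP/injectiveP => sI i j.
    move=> sij; apply: (can_inj (permKV p)); apply: sI; by rewrite !ffunE !permKV.
  by rewrite !ffunE => /sI/perm_inj.
rewrite !indicE; congr (_%:R); congr nat_of_bool.
apply/idP/idP => /set_mem /= H; apply/mem_set => /= i.
  by have := H ((p^-1)%g i); rewrite ffunE tpi permKV.
by rewrite ffunE tpi.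
Qed.

(** Handing sorted times to a uniformly random enumeration gives the elements independent uniform
    times. Conditioning on the enumeration gives the average of [P (M s)] over all [s]; the average
    is unchanged when the times are unsorted, and then every term is the product. *)
Lemma order_times_law (A : E -> set R) : (forall x, measurable (A x)) ->
  measurable [set w | forall i, A (r w i) (tnth (sorted_times U w) i)] /\
  P [set w | forall i, A (r w i) (tnth (sorted_times U w) i)] =
  (\prod_x uniform_prob (@ltr01 R) (A x))%E.
Proof.
move=> mA.
pose M (s : {ffun 'I_n -> E}) := [set w | forall i, A (s i) (tnth (sorted_times U w) i)].
pose N (s : {ffun 'I_n -> E}) := [set w | forall i, A (s i) (U i w)].
have mN s : measurable (N s).
  by apply: (measurable_all_times (A := fun i => A (s i))).
have MG s : <<s G >> (M s).
  by apply: (measurable_all_sorted (A := fun i => A (s i))).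
have sGm : <<s G >> `<=` measurable.
  apply: smallest_sub; first exact: sigma_algebra_measurable.
  by move=> _ [B [mB ->]]; exact: measurable_all_times.
have mr s : measurable (r @^-1` [set s]).
  case: (boolP (injectiveb s)) => [/injectiveP sI|/injectiveP sI].
    by have [] := ur.2 s sI.
  rewrite [X in measurable X](_ : _ = set0)// -subset0 => w /= rws.
  by apply: sI; rewrite -rws; exact: ur.1.
set L := [set w | _].
pose S s := r @^-1` [set s] `&` M s.
have LE w : \1_L w = \sum_(s : {ffun 'I_n -> E} | injectiveb s) \1_(S s) w :> R.
  rewrite (bigD1 (r w)) /=; last by apply/injectiveP; exact: ur.1.
  rewrite big1 ?addr0; last first.
    move=> s /andP[_ srw]; rewrite indicE memNset// /S => -[/= rws _].
    by rewrite rws eqxx in srw.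
  rewrite !indicE; congr (_%:R); congr nat_of_bool.
  by apply/idP/idP => /set_mem h; apply/mem_set; [split|case: h].
have mS s : measurable (S s) by apply: measurableI => //; apply: sGm; exact: MG.
have mL : measurable L.
  rewrite (_ : L = \bigcup_(s in [set: {ffun 'I_n -> E}]) S s).
    by apply: fin_bigcup_measurable => //; exact: finite_finset.
  by apply/seteqP; split=> [w Lw|w [s _ [/= <-]]//]; exists (r w).
split=> //; have -> : P L = (\sum_(s : {ffun 'I_n -> E} | injectiveb s) P (S s))%E.
  transitivity (\sum_(i : 'I_1) P L)%E; first by rewrite big_ord1.
  by apply: sum_measure_indic => // w; rewrite big_ord1.
transitivity (\sum_(s : {ffun 'I_n -> E} | injectiveb s) ((n`!)%:R^-1)%:E * P (M s))%E.
  apply: eq_bigr => s /injectiveP sI.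
  by rewrite (order_indep_times sI (MG s)).2 (ur.2 s sI).2.
rewrite -ge0_sume_distrr; last by move=> s _; exact: measure_ge0.
have mM s : measurable (M s) by apply: sGm; exact: MG.
(* Sorting can be undone only under the sum: [P (M s)] and [P (N s)] may differ for an individual
   [s]. *)
rewrite (sum_measure_indic P mM mN (sum_sorted_times A)).
rewrite (eq_bigr (fun=> \prod_x uniform_prob (@ltr01 R) (A x))%E); last first.
  move=> s /injectiveP sI.
  have mAs i : measurable (A (s i)) by [].
  have := ind setT mAs; rewrite preimage_setT setTI probability_setT mul1e.
  move=> ->; rewrite (eq_bigr (fun i => uniform_prob (@ltr01 R) (A (s i)))); last first.
    by move=> i _; exact: (uU i (mAs i)).
  rewrite [RHS](reindex s)//; apply: onW_bij.
  by apply: inj_card_bij => //; rewrite card_ord cardE.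
have -> : (\prod_x uniform_prob (@ltr01 R) (A x) =
    (\prod_x fine (uniform_prob (@ltr01 R) (A x)))%:E)%E.
  rewrite -prodEFin; apply: eq_bigr => x _.
  by rewrite fineK//; apply: fin_num_measure; exact: mA.
rewrite sumEFin sumr_const -EFinM; congr EFin.
rewrite (_ : #|_| = n`!); last first.
  have := card_inj_ffuns 'I_n E; rewrite card_ord cardE ffactnn => <-.
  by rewrite cardsE.
by rewrite -[X in _ * X]mulr_natl mulrA mulVf ?mul1r// pnatr_eq0 -lt0n fact_gt0.
Qed.
End Law.

Lemma uniform_prob_itvco (R : realType) (a b : R) : 0 <= a -> a <= b -> b <= 1 ->
  uniform_prob (@ltr01 R) [set` `[a, b[] = (b - a)%:E.
Proof.
move=> a0 ab b1; rewrite /uniform_prob integral_uniform_pdf setIidl; last first.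
  by move=> x /=; rewrite !in_itv/= => /andP[h1 h2];
    rewrite (le_trans a0)//= (ltW (lt_le_trans h2 _)).
rewrite (eq_integral (cst 1%E)); last first.
  move=> x /set_mem/=; rewrite in_itv/= /uniform_pdf => /andP[h1 h2].
  by rewrite (le_trans a0 h1) (ltW (lt_le_trans h2 b1)) subr0 invr1.
rewrite integral_cst//= mul1e. rewrite lebesgue_measure_itv/= lte_fin.
case: ltP => [//|ba]; have -> : b = a by apply/le_anti; rewrite ba ab.
by rewrite subrr.
Qed.

Lemma absz_ceil_le (R : realType) (z : R) (k : nat) : 0 <= z ->
  (`|Num.ceil z|%N <= k)%N = (z <= k%:R).
Proof.
move=> z0; rewrite -lez_nat gez0_abs ?ceil_le_int//.
by rewrite ceil_ge0 (lt_le_trans _ z0).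
Qed.

(** * Top segments of the order and their sizes *)

Section OPT_lemmas.
Context {disp : Order.disp_t} {E : finOrderType disp}.

Lemma OPT_up m (x y : E) : x \in OPT m -> (x < y)%O -> y \in OPT m.
Proof.
rewrite !inE => h xy; apply: leq_ltn_trans h; apply/subset_leq_card.
by apply/fintype.subsetP => z; rewrite !inE; apply: lt_trans.
Qed.

Lemma card_OPT_le m : (#|(OPT m : {set E})| <= m)%N.
Proof.
have [->|/set0Pn[x xO]] := eqVneq (OPT m : {set E}) finset.set0.
  by rewrite cards0.
case: (Order.TotalTheory.arg_minP id xO) => y yO ymin.
have {}yO : y \in OPT m by exact: yO.
move: (yO); rewrite inE => ym; rewrite (cardsD1 y) yO add1n.
apply: leq_ltn_trans ym; apply/subset_leq_card/fintype.subsetP => z.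
rewrite finset.in_setD1 => /andP[zy zO]; rewrite inE lt_neqAle eq_sym zy /=.
exact: ymin.
Qed.

Lemma card_OPT_ge m : (0 < m <= #|E|)%N -> (m <= #|(OPT m : {set E})|)%N.
Proof.
rewrite -cardsT => /kth_highest_exists[y _ [_ <-]].
set k := #|_|; apply/subset_leq_card/fintype.subsetP => x; rewrite !inE /= => yx.
rewrite /k; apply: proper_card; apply/properP; split.
  apply/fintype.subsetP => z; rewrite !inE /= => /ltW; exact: le_trans.
by exists x; rewrite !inE ?ltxx.
Qed.

Lemma OPT_setT m : (#|E| < m)%N -> OPT m = [set: E]%SET.
Proof.
move=> Em; apply/finset.setP => x; rewrite !inE; apply: leq_ltn_trans Em.
exact: max_card.
Qed.
End OPT_lemmas.

(** Length of the window in [J_ j], times [1 - 3 * rho ^ (-1/2)] for the three failures. *)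
Definition window_weight (R : realType) (rho : nat) (eps : nat -> R) (j : nat) : R :=
  2 ^- j.+1 / ((1 + 5 * eps j) * (1 + 3 * eps j)) *
  (1 - 3 * expR (- (2^-1 * ln rho%:R))).

(** * Success probability of one window *)

Section Arrival.
Context {d : measure_display} {T : measurableType d} {R : realType}.
Variable P : probability T R.
Context {n : nat} {disp : Order.disp_t} {E : finOrderType disp}.
Variables (U : 'I_n -> {RV P >-> R}) (r : T -> {ffun 'I_n -> E}).
Hypotheses (uU : uniform_times U) (ur : uniform_order P r)
  (ind : independent_order_times r U).
Hypothesis cardE : #|E| = n.

Definition arrival_time w : E -> R := arrival (sorted_times U w) (r w).

Lemma arrival_law (A : E -> set R) : (forall x, measurable (A x)) ->
  measurable [set w | forall x, A x (arrival_time w x)] /\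
  P [set w | forall x, A x (arrival_time w x)] =
  (\prod_x uniform_prob (@ltr01 R) (A x))%E.
Proof.
move=> mA; rewrite [X in measurable X /\ P X = _](_ : _ =
  [set w | forall i, A (r w i) (tnth (sorted_times U w) i)]).
  exact: (order_times_law uU ur ind cardE).
apply/seteqP; split=> w /= h i.
  by have := h (r w i); rewrite /arrival_time arrivalE//; exact: ur.1.
have [k <-] := arrival_order_surj (ur.1 w) cardE i.
by rewrite /arrival_time arrivalE//; exact: ur.1.
Qed.

(** [F] splits according to the exact set [Q] of elements of [S] arriving in [B]; each piece is a
    product event. As [e] is not in [S], its own arrival contributes the separate factor [p]. *)
Lemma pattern_law (e : E) (S : {set E}) (W B : interval R) (p b : R)
    (D : pred {set E}) : e \notin S ->
  uniform_prob (@ltr01 R) [set` W] = p%:E ->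
  uniform_prob (@ltr01 R) [set` B] = b%:E ->
  let F := [set w | (arrival_time w e \in W) &&
    D [set x in S | arrival_time w x \in B]%SET] in
  measurable F /\
  P F = (p * \sum_(Q : {set E} | (Q \subset S) && D Q)
      \prod_(x in S) (if x \in Q then b else 1 - b))%:E.
Proof.
move=> eS uW uB F.
pose A (Q : {set E}) x : set R := if x == e then [set` W] else
  if x \in S then (if x \in Q then [set` B] else ~` [set` B]) else setT.
have mA Q x : measurable (A Q x).
  rewrite /A; do !case: ifP => // _; do ?[exact: measurable_itv].
  by apply: measurableC; exact: measurable_itv.
pose H Q := [set w | forall x, A Q x (arrival_time w x)].
have mH Q : measurable (H Q) by have [] := arrival_law (mA Q).
have HP (Q : {set E}) w : Q \subset S -> H Q w <->
    arrival_time w e \in W /\ [set x in S | arrival_time w x \in B]%SET = Q.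
  move=> QS; split=> [h|[h1 h2] x].
    split; first by have := h e; rewrite /A eqxx.
    apply/finset.setP => x; rewrite finset.in_set; have := h x; rewrite /A.
    case: (eqVneq x e) => [->|xe].
      by rewrite (negbTE eS)/= => _; apply/esym/negbTE; apply: contra eS;
        exact: (fintype.subsetP QS).
    case: ifPn => xS; last first.
      by move=> _; apply/esym/negbTE; apply: contra xS; exact: (fintype.subsetP QS).
    by case: ifP => _ /= => [->|/negP/negbTE].
  rewrite /A; case: eqP => [->//|_]; case: ifP => // xS.
  by rewrite -h2 finset.in_set xS /=; case: ifP => //= /negbT/negP.
have sub_S w : [set x in S | arrival_time w x \in B]%SET \subset S.
  by apply/fintype.subsetP => x; rewrite finset.in_set => /andP[].
have FE w : \1_F w = \sum_(Q : {set E} | (Q \subset S) && D Q) \1_(H Q) w :> R.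
  set Q0 := [set x in S | arrival_time w x \in B]%SET.
  rewrite indicE; case: (boolP (w \in F)) => [/set_mem/andP[wW wD]|wF].
    rewrite (bigD1 Q0)/=; last by rewrite sub_S.
    rewrite big1 ?addr0 => [|Q /andP[/andP[QS _] /eqP QQ0]].
      by rewrite indicE mem_set//; exact: ((HP _ _ (sub_S w)).2 (conj wW erefl)).
    by rewrite indicE memNset// => /(HP _ _ QS)[_ /esym].
  rewrite big1// => Q /andP[QS DQ]; rewrite indicE memNset// => /(HP _ _ QS)[wW QE].
  by move/negP: wF; apply; apply/mem_set; rewrite /F /= wW QE.
have mF : measurable F.
  rewrite (_ : F = \bigcup_(Q in [set Q : {set E} | (Q \subset S) && D Q]) H Q).
    by apply: fin_bigcup_measurable => //; exact: finite_finset.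
  apply/seteqP; split=> [w /andP[wW wD]|w [Q /= /andP[QS DQ] /(HP _ _ QS)[wW QE]]].
    exists [set x in S | arrival_time w x \in B]%SET; first by rewrite /= sub_S.
    exact: ((HP _ _ (sub_S w)).2 (conj wW erefl)).
  by rewrite /F /= wW QE.
split=> //; transitivity (\sum_(i : 'I_1) P F)%E; first by rewrite big_ord1.
rewrite (@sum_measure_indic _ _ _ P _ _ predT
  (fun Q : {set E} => (Q \subset S) && D Q) (fun=> F) H)//; last first.
  by move=> w; rewrite big_ord1.
rewrite mulr_sumr -sumEFin; apply: eq_bigr => Q _.
rewrite (arrival_law (mA Q)).2 (bigD1 e)//= {1}/A eqxx uW.
rewrite big_mkcond [in RHS]big_mkcond EFinM -prodEFin; congr (_ * _)%E.
apply: eq_bigr => x _; case: eqP => [->|/eqP xe] /=; first by rewrite (negbTE eS).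
rewrite /A (negbTE xe); case: ifP => xS; last exact: probability_setT.
case: ifP => // _; rewrite probability_setC; last exact: measurable_itv.
by rewrite -[X in (_ - X)%E]/(uniform_prob (@ltr01 R) [set` B]) uB.
Qed.

(** [G] is the arrival of [e] in the window minus three failure events. Each of these includes that
    arrival, so it has probability at most [wd * dl], and the union bound loses only a fraction
    [3 * dl] of [wd]. *)
Lemma accept_window (rho : nat) (eps : nat -> R) (j : nat) (e : E) :
  let p : R := 2 ^- j.+1 in
  (0 < rho)%N -> 0 <= eps j <= 2 ->
  eps j ^+ 2 * (p * rho%:R) = 6 * ln rho%:R -> 1 <= eps j * rho%:R ->
  e \in OPT rho ->
  exists G : set T, [/\ measurable G,
    forall w, G w -> arrival_time w e \in J_ j /\
      e \in ALG rho eps (sorted_times U w) (r w) &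
    ((window_weight rho eps j)%:E <= P G)%E].
Proof.
move=> p rho0 eps02 epsq epsr eO; rewrite /window_weight -/p;
  set ep := eps j in eps02 epsq epsr *.
(* The factor [1 + 5 * ep] bounds [M / rho], the rounding in [M] being absorbed by [1 <= ep * rho];
   the factor [1 + 3 * ep] is the slack for the Chernoff bound in the window. *)
set dl := expR _; set wd := p / _.
have [ep0 ep2] := andP eps02.
have p0 : 0 < p by rewrite invr_gt0 exprn_gt0.
have p12 : p <= 2^-1.
  by rewrite /p -exprVn exprS ler_piMr ?exprn_ile1 ?invr_ge0//; lra.
have rhoR : 0 < rho%:R :> R by rewrite ltr0n.
have den1 : 1 <= (1 + 5 * ep) * (1 + 3 * ep) by nra.
have wd0 : 0 <= wd by rewrite divr_ge0//; lra.
have wdp : wd <= p by rewrite ler_pdivrMr; nra.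
pose W : interval R := `[p, p + wd[; pose B : interval R := I_ j.+1.
have uW : uniform_prob (@ltr01 R) [set` W] = wd%:E.
  by rewrite uniform_prob_itvco; [congr EFin|..]; lra.
have uB : uniform_prob (@ltr01 R) [set` B] = p%:E.
  by rewrite uniform_prob_itvco ?subr0// -/p; lra.
pose M := `|Num.ceil ((1 + 4 * ep) * rho%:R)|%N.
have zM0 : 0 <= (1 + 4 * ep) * rho%:R by apply: mulr_ge0; lra.
have Mge : (1 + 4 * ep) * rho%:R <= M%:R by rewrite -absz_ceil_le.
have Mle : M%:R <= (1 + 4 * ep) * rho%:R + 1.
  rewrite leNgt; apply/negP => lt1; have : (M <= M.-1)%N.
    rewrite {1}/M absz_ceil_le//; case: (M) lt1 => [|M'] /=; first lra.
    by rewrite -natr1; lra.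
  by case: (M) lt1 => [|M'] /=; [lra|rewrite ltnn].
have rhoM : (rho <= M)%N by rewrite -(@ler_nat R); nra.
(* One more than [M], so that removing [e] leaves at most [M] elements, and at least [M] when
   [M < n]. *)
pose top : {set E} := OPT M.+1.
have etop : e \in top.
  by move: eO; rewrite !inE => /leq_trans; apply; exact: leqW.
pose z := p * (1 + ep) * rho%:R.
have z0 : 0 < z by rewrite !mulr_gt0//; lra.
have quotaE k : (quota rho eps j <= k)%N = (z <= k%:R).
  by rewrite /quota absz_ceil_le ?(ltW z0).
(* [D1], [D2] and [D3] are the failures of the three conditions on the window. *)
pose S1 : {set E} := [set x | (e < x)%O]%SET.
pose D1 (Q : {set E}) := (quota rho eps j <= #|Q|)%N.
pose S2 : {set E} := top :\ e.
pose D2 (Q : {set E}) := (M < n)%N && (#|Q| < quota rho eps j)%N.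
pose D3 (Q : {set E}) := (p * rho%:R <= #|Q|%:R :> R).
have eS1 : e \notin S1 by rewrite inE ltxx.
have eS2 : e \notin S2 by rewrite !inE eqxx.
have e0 : e \notin (finset.set0 : {set E}) by rewrite inE.
(* With an empty [S] and no condition, this is just the arrival of [e] in the window. *)
have [mV PV] := pattern_law predT e0 uW uB.
have [mF1 PF1] := pattern_law D1 eS1 uW uB.
have [mF2 PF2] := pattern_law D2 eS2 uW uB.
have [mF3 PF3] := pattern_law D3 eS2 uW uW.
set V := [set w | _] in mV PV; set F1 := [set w | _] in mF1 PF1.
set F2 := [set w | _] in mF2 PF2; set F3 := [set w | _] in mF3 PF3.
have cS1 : #|S1|%:R <= rho%:R :> R by move: eO; rewrite inE ler_nat => /ltnW.
have cS2 : (#|top| = #|S2|.+1)%N by rewrite (cardsD1 e) etop.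
have cS2M : #|S2|%:R <= M%:R :> R.
  by rewrite ler_nat -ltnS -cS2 card_OPT_le.
have cS2ge : (M < n)%N -> M%:R <= #|S2|%:R :> R.
  by move=> Mn; rewrite ler_nat -ltnS -cS2 card_OPT_ge// cardE.
have p01 : 0 <= p <= 1 by lra.
have wd01 : 0 <= wd <= 1 by lra.
have q0 : 0 <= p * rho%:R by rewrite mulr_ge0// ltW.
have {PV} PV : P V = wd%:E.
  rewrite PV; congr EFin; under eq_bigl do rewrite andbT.
  by rewrite sum_subsets cards0 expr0 mulr1.
have {PF1} PF1 : (P F1 <= (wd * dl)%:E)%E.
  rewrite PF1 lee_fin ler_wpM2l//.
  apply: le_trans (chernoff_subsets (l := ep / 4) (a := z) p01 _) _.
    by move=> Q _; rewrite /D1 quotaE => zQ; rewrite ler_wpM2l//; lra.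
  rewrite ler_expR; apply: le_trans (exponent_upper q0 eps02 epsq).
  rewrite /z [p * (1 + ep)]mulrC -!mulrA lerD2l [#|S1|%:R * _]mulrCA.
  rewrite ler_wpM2l ?(ltW p0)// ler_wpM2r// subr_ge0 -[X in X <= _]expR0 ler_expR.
  by rewrite divr_ge0.
have {PF2} PF2 : (P F2 <= (wd * dl)%:E)%E.
  rewrite PF2 lee_fin ler_wpM2l//.
  (* When [n <= M], [top] is the whole ground set and this failure cannot occur. *)
  case: (boolP (M < n)%N) => Mn; last first.
    rewrite big1 ?expR_ge0// => Q; by rewrite /D2 (negbTE Mn) /= andbF.
  apply: le_trans (chernoff_subsets (l := - (ep / 6)) (a := z) p01 _) _.
    move=> Q _; rewrite /D2 Mn /= ltnNge quotaE -ltNge => /ltW zQ.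
    by rewrite ler_wnM2l// oppr_le0 divr_ge0.
  rewrite ler_expR; apply: le_trans (exponent_lower q0 eps02 epsq).
  rewrite /z [p * (1 + ep)]mulrC -[(1 + ep) * p * _]mulrA lerD2l.
  rewrite [(1 + 4 * ep) * _]mulrCA [#|S2|%:R * _]mulrC ler_wnM2r//.
    by rewrite subr_le0 -[X in _ <= X]expR0 ler_expR oppr_le0 divr_ge0.
  by rewrite ler_wpM2l ?(ltW p0)// (le_trans Mge)// cS2ge.
have {PF3} PF3 : (P F3 <= (wd * dl)%:E)%E.
  rewrite PF3 lee_fin ler_wpM2l//.
  apply: le_trans (chernoff_subsets (l := ep / 4) (a := p * rho%:R) wd01 _) _.
    by move=> Q _; rewrite /D3 => zQ; rewrite ler_wpM2l//; lra.
  rewrite ler_expR; apply: le_trans (exponent_window q0 eps02 epsq).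
  rewrite lerD2l ler_wpM2r//.
    by rewrite subr_ge0 -[X in X <= _]expR0 ler_expR divr_ge0.
  have -> : p * rho%:R / (1 + 3 * ep) = (1 + 5 * ep) * rho%:R * wd.
    rewrite /wd; field; apply/andP; split; apply: lt0r_neq0; lra.
  by rewrite ler_wpM2r//; nra.
pose G := V `\` (F1 `|` (F2 `|` F3)).
have mG : measurable G by apply: measurableD => //; apply: measurableU => //;
  exact: measurableU.
exists G; split=> //.
  move=> w [/andP[wW _] nF]; have tJ : arrival_time w e \in J_ j.
    move: wW; rewrite !in_itv/= -/p => /andP[-> h]; apply: lt_le_trans h _.
    have -> : 2 ^- j = 2 * p by rewrite /p exprS invfM mulrA divff// mul1r.
    by rewrite mulr_natl mulr2n lerD2l.
  split=> //.
  have nF1 : ~~ D1 [set x in S1 | arrival_time w x \in B]%SET.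
    by apply/negP => h; apply: nF; left; rewrite /F1 /= wW h.
  have nF2 : ~~ D2 [set x in S2 | arrival_time w x \in B]%SET.
    by apply/negP => h; apply: nF; right; left; rewrite /F2 /= wW h.
  have nF3 : ~~ D3 [set x in S2 | arrival_time w x \in W]%SET.
    by apply/negP => h; apply: nF; right; right; rewrite /F3 /= wW h.
  apply: (@mem_ALG R disp E n rho eps (sorted_times U w) (r w) (ur.1 w) cardE _ j e top) => //.
  - exact: sort_le_sorted.
  - move: nF1; rewrite /D1 -ltnNge; apply: leq_ltn_trans.
    apply/subset_leq_card/fintype.subsetP => x.
    by rewrite !finset.in_set => /andP[-> ->].
  - by move=> x y; exact: OPT_up.
  - by rewrite ltnNge quotaE -ltNge.
  - case: (leqP n M) => Mn; first by left; apply: OPT_setT; rewrite cardE ltnS.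
    right; move: nF2; rewrite /D2 Mn /= -leqNgt => /leq_trans; apply.
    apply/subset_leq_card/fintype.subsetP => x; rewrite finset.in_set => /andP[xS2 xB].
    rewrite finset.in_setI; apply/andP; split; last by rewrite /sample finset.in_set.
    by move: xS2; rewrite finset.in_setD1 => /andP[].
  (* The window starts where [J_ j] starts, so whatever arrives in [J_ j] no later than [e] arrives
     in the window. *)
  move: nF3; rewrite /D3 -ltNge; apply: le_lt_trans; rewrite ler_nat.
  apply/subset_leq_card/fintype.subsetP => x;
    rewrite !finset.in_set => /andP[-> /andP[xJ xe]].
  move: xJ wW; rewrite /W !in_itv/= -/p => /andP[-> _] /andP[_]; exact: le_lt_trans.
have VG : V `<=` G `|` (F1 `|` (F2 `|` F3)).
  by move=> w Vw; case: (pselect ((F1 `|` (F2 `|` F3)) w)) => h; [right|left].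
have mF : measurable (F1 `|` (F2 `|` F3)) by apply: measurableU => //;
  exact: measurableU.
have : (P V <= P G + (P F1 + (P F2 + P F3)))%E.
  have /le_trans := le_measure P (mem_set mV) (mem_set (measurableU _ _ mG mF)) VG.
  apply.
  apply: le_trans (measureU2 P mG mF) _; rewrite leeD2l//.
  apply: le_trans (measureU2 P mF1 (measurableU _ _ mF2 mF3)) _; rewrite leeD2l//.
  exact: measureU2.
have Pfin X : measurable X -> P X = (fine (P X))%:E by move=> mX;
  rewrite fineK// fin_num_measure.
move: PF1 PF2 PF3; rewrite PV (Pfin _ mG) (Pfin _ mF1) (Pfin _ mF2) (Pfin _ mF3).
rewrite -!EFinD !lee_fin; lra.
Qed.
End Arrival.

(** * Summing over the windows *)

Section Constants.
Context {R : realType}.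
Implicit Types rho : nat.

Lemma ln_ge1 rho : (96 <= rho)%N -> 1 <= ln rho%:R :> R.
Proof.
move=> h; have rho0 : 0 < rho%:R :> R by rewrite ltr0n; exact: leq_trans h.
have h96 : 96 <= rho%:R :> R by rewrite -[96]/(96%:R) ler_nat.
rewrite -ler_expR lnK ?posrE//; apply: le_trans h96.
have -> : expR 1 = expR 2^-1 ^+ 2 :> R by rewrite -expRM_natr mulVf.
have : expR 2^-1 <= 2 :> R.
  apply: le_trans (expR_le_sub1V _) _; first by lra.
  by rewrite (_ : 1 - 2^-1 = 2^-1) ?invrK//; lra.
have := expR_ge0 (2^-1 : R); nra.
Qed.

(** The square root of [rho] is [expR (ln rho / 2)], hence at least [1 + ln rho / 2]. *)
Lemma ln_sqr_le rho : (0 < rho)%N -> (1 <= ln rho%:R :> R) ->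
  (ln rho%:R) ^+ 2 <= 4 * rho%:R :> R.
Proof.
move=> rho0 ln1; have rhoR : 0 < rho%:R :> R by rewrite ltr0n.
have h : 1 + 2^-1 * ln rho%:R <= expR (2^-1 * ln rho%:R) :> R by exact: expR_ge1Dx.
have e2 : expR (2^-1 * ln rho%:R) ^+ 2 = rho%:R :> R.
  by rewrite -expRM_natr mulrAC mulVf ?mul1r// lnK.
rewrite -[X in _ <= 4 * X]e2; move: h; set y := expR _; set L := ln _ in ln1 *; nra.
Qed.

Lemma half_ln_sqr rho : (0 < rho)%N ->
  (expR (- (2^-1 * ln rho%:R)) : R) ^+ 2 = (rho%:R)^-1.
Proof.
move=> rho0; rewrite -expRM_natr mulNr mulrAC mulVf ?mul1r// expRN lnK//.
by rewrite posrE ltr0n.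
Qed.

(** Taking logarithms in [4 ^ j <= rho / 96] gives the range of [j] in [eps_spec]. *)
Lemma eps_prescribed rho (eps : nat -> R) j : (96 <= rho)%N -> eps_spec rho eps ->
  (96 * 4 ^ j <= rho)%N -> eps j = Num.sqrt (12 * 2 ^+ j * ln rho%:R / rho%:R).
Proof.
move=> h96 [_ +] jrho; apply; rewrite floor_ge_int.
have ln2 : 0 < ln 2 :> R by rewrite ln_gt0// ltr1n.
rewrite mulrA ler_pdivlMr// [2^-1 * _]mulrC ler_pdivlMr// -mulrA mulrC.
have -> : ln 2 * 2 * j%:~R = ln (4 ^+ j) :> R.
  rewrite lnXn// (_ : 4 = 2 ^+ 2 :> R); last by rewrite -natrX.
  by rewrite lnXn// -[RHS]mulr_natr -[ln 2 *+ 2]mulr_natr.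
rewrite ler_ln ?posrE ?exprn_gt0 ?divr_gt0 ?ltr0n//; last exact: leq_trans h96.
by rewrite ler_pdivlMr ?ltr0n// mulrC -natrX -natrM ler_nat.
Qed.

(** The bound [ep <= 2] rests on [3 * 2 ^ j * ln rho <= rho], which follows from [96 * 4 ^ j <= rho]
    and [ln_sqr_le]. In the last bound [3 / 2] replaces the square root of 2: powers stay integral,
    and the ratio [3 / 4] left after multiplying by [2 ^- j] is still summable. *)
Lemma eps_facts rho (ep : R) j : (96 <= rho)%N -> (96 * 4 ^ j <= rho)%N ->
  ep = Num.sqrt (12 * 2 ^+ j * ln rho%:R / rho%:R) ->
  [/\ 0 <= ep <= 2, ep ^+ 2 * (2 ^- j.+1 * rho%:R) = 6 * ln rho%:R,
    1 <= ep * rho%:R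
  & ep <= 4 * (3 / 2) ^+ j * Num.sqrt (ln rho%:R / rho%:R)].
Proof.
move=> h96 jrho epE; have rho0 : (0 < rho)%N by exact: leq_trans h96.
have rhoR : 0 < rho%:R :> R by rewrite ltr0n.
have ln1 := ln_ge1 h96.
set x : R := 2 ^+ j in epE *; set L : R := ln _ in epE ln1 *.
have x1 : 1 <= x by rewrite /x exprn_ege1// ler1n.
have x2 : 96 * x ^+ 2 <= rho%:R.
  by rewrite /x -exprM mulnC exprM -!natrX -natrM ler_nat.
have L2 : L ^+ 2 <= 4 * rho%:R by exact: ln_sqr_le.
have ep2 : ep ^+ 2 * rho%:R = 12 * x * L.
  by rewrite epE sqr_sqrtr ?divfK ?gt_eqF// divr_ge0//; nra.
have ep0 : 0 <= ep by rewrite epE sqrtr_ge0.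
have xL : 3 * (x * L) <= rho%:R.
  have xL0 : 0 <= x * L by rewrite mulr_ge0//; lra.
  have h : (96 * x ^+ 2) * L ^+ 2 <= rho%:R * (4 * rho%:R).
    apply: ler_pM x2 L2; last exact: sqr_ge0.
    by apply: mulr_ge0 => //; exact: sqr_ge0.
  rewrite -ler_sqr ?nnegrE ?(ltW rhoR)//; last by rewrite mulr_ge0.
  have := sqr_ge0 (rho%:R : R); rewrite !exprMn; lra.
have ep_le2 : ep <= 2.
  rewrite -ler_sqr ?nnegrE// -(ler_pM2r rhoR) ep2; lra.
split.
- by rewrite ep0.
- rewrite mulrCA mulrC ep2 exprS -/x invfM; field.
  by rewrite gt_eqF//; lra.
- nra.
rewrite epE (_ : 12 * x * L / rho%:R = 12 * x * (L / rho%:R)); last by rewrite mulrA.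
rewrite sqrtrM; last by nra.
rewrite ler_wpM2r ?sqrtr_ge0// -ler_sqr ?nnegrE ?sqrtr_ge0 ?mulr_ge0 ?exprn_ge0//.
rewrite sqr_sqrtr; last by nra.
have : x <= ((3 / 2) ^+ j) ^+ 2.
  rewrite /x -exprM mulnC exprM lerXn2r ?nnegrE// expr2; lra.
rewrite exprMn; nra.
Qed.

(** The sum is at least [1 - 77 * s] and at least [1 / 231]; the first bound is used when
    [2 * 77 * s <= 1], the second otherwise. In the first, [77 = 10 + 64 + 3]: missing windows, the
    [eps j], and the failures. In the second, [231 = 3 * 77] with [77 = 11 * 7] the value of
    [(1 + 5 * x) * (1 + 3 * x)] at [x = 2], the rest being [1 / 2] times [1 - 3 * dl >= 2 / 3]. *)
Lemma window_sum_ge rho (eps : nat -> R) : (96 <= rho)%N -> eps_spec rho eps ->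
  (1 + 2 * 77 * 231 * Num.sqrt (ln rho%:R / rho%:R))^-1 <=
  \sum_(j < (trunc_log 4 (rho %/ 96)).+1) window_weight rho eps j.
Proof.
move=> h96 epsP; set J := trunc_log _ _; set s := Num.sqrt _.
pose dl : R := expR (- (2^-1 * ln rho%:R)); pose w := window_weight rho eps.
have wE j : w j = 2 ^- j.+1 / ((1 + 5 * eps j) * (1 + 3 * eps j)) * (1 - 3 * dl).
  by [].
rewrite -/w.
have rho0 : (0 < rho)%N by exact: leq_trans h96.
have rhoR : 0 < rho%:R :> R by rewrite ltr0n.
have ln1 := ln_ge1 h96.
have h96R : 96 <= rho%:R :> R by rewrite -[96]/(96%:R) ler_nat.
have q0 : (0 < rho %/ 96)%N by rewrite divn_gt0.
have [J1 J2] : (4 ^ J <= rho %/ 96)%N /\ (rho %/ 96 < 4 ^ J.+1)%N.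
  by have /andP[] := trunc_log_bounds (isT : 1 < 4)%N q0.
have jrho j : (j <= J)%N -> (96 * 4 ^ j <= rho)%N.
  move=> jJ; rewrite mulnC -leq_divRL//; apply: leq_trans J1; exact: leq_pexp2l.
have facts j : (j <= J)%N -> _ :=
  fun jJ => eps_facts h96 (jrho _ jJ) (eps_prescribed h96 epsP (jrho _ jJ)).
have s0 : 0 <= s by exact: sqrtr_ge0.
have s2 : s ^+ 2 * rho%:R = ln rho%:R by rewrite sqr_sqrtr ?divfK ?gt_eqF ?divr_ge0//;
  lra.
have dl0 : 0 <= dl by exact: expR_ge0.
have dl2 : dl ^+ 2 * rho%:R = 1 by rewrite half_ln_sqr// mulVf ?gt_eqF.
have dls : dl <= s by rewrite -ler_sqr ?nnegrE// -(@ler_pM2r _ rho%:R)// s2 dl2.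
have dl9 : 9 * dl <= 1.
  rewrite leNgt; apply/negP => h; have : 1 < 81 * dl ^+ 2 by nra.
  have := ler_wpM2l (sqr_ge0 dl) h96R; lra.
have w0 j : (j <= J)%N -> 0 <= w j.
  move=> /facts[/andP[e0 _] _ _ _]; rewrite wE mulr_ge0//; last lra.
  by rewrite divr_ge0 ?invr_ge0 ?exprn_ge0// mulr_ge0; lra.
(* For small rho the sum bound [lb1] may be negative; the first window alone
   gives a positive constant. *)
have lb0 : 231^-1 <= \sum_(j < J.+1) w j.
  rewrite big_ord_recl /=; have [/andP[e0 e2] _ _ _] := facts 0%N (leq0n _).
  apply: (@le_trans _ _ (w 0%N)); last first.
    by rewrite lerDl sumr_ge0// => i _; apply: w0.
  rewrite wE expr1 -mulrA.
  have : 77^-1 <= ((1 + 5 * eps 0%N) * (1 + 3 * eps 0%N))^-1.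
    by rewrite lef_pV2 ?posrE; nra.
  nra.
have lb1 : 1 - 77 * s <= \sum_(j < J.+1) w j.
  (* [1 / ((1 + 5 x) (1 + 3 x)) >= 1 - 8 x] and [2 ^+ j <= (3 / 2) ^+ j.*2]. *)
  pose v j : R := 2 ^- j.+1 - 16 * s * (3 / 4) ^+ j.
  have vw j : (j <= J)%N -> v j * (1 - 3 * dl) <= w j.
    move=> /facts[/andP[e0 e2] _ _ e3]; rewrite wE ler_wpM2r//; first lra.
    have p0 : 0 < 2 ^- j.+1 :> R by rewrite invr_gt0 exprn_gt0.
    apply: (@le_trans _ _ (2 ^- j.+1 * (1 - 8 * eps j))).
      rewrite mulrBr mulr1 lerD2l lerN2.
      have : 2 ^- j.+1 * (8 * eps j) <= 2 ^- j.+1 * (8 * (4 * (3 / 2) ^+ j * s)).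
        by rewrite ler_wpM2l ?(ltW p0)// ler_wpM2l.
      move=> /le_trans; apply.
      have -> : (3 / 4) ^+ j = (3 / 2) ^+ j * 2 ^- j :> R.
        by rewrite -exprVn -exprMn; congr (_ ^+ _); field.
      by rewrite exprS invfM le_eqVlt; apply/orP; left; apply/eqP; field;
        rewrite expf_neq0.
    rewrite ler_wpM2l ?(ltW p0)// -[leRHS]mul1r ler_pdivlMr; nra.
  have sumv m : \sum_(j < m) v j = 1 - 2 ^- m - 64 * s * (1 - (3 / 4) ^+ m).
    elim: m => [|m IH]; first by rewrite big_ord0 !expr0 invr1; ring.
    rewrite big_ord_recr /= IH /v !exprS invfM; field.
    by rewrite expf_neq0.
  (* The mass of the windows beyond [J]: by maximality of [J], [rho <= 96 * 4 ^ J.+1], and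
     [96 <= 10 ^ 2]. *)
  have tail : 2 ^- J.+1 <= 10 * s.
    apply: (@le_trans _ _ (10 * dl)); last by rewrite ler_wpM2l.
    rewrite -ler_sqr ?nnegrE ?mulr_ge0 ?invr_ge0 ?exprn_ge0//.
    rewrite exprVn -exprM mulnC exprM -[2 ^+ 2]natrX.
    rewrite -div1r ler_pdivrMr ?exprn_gt0//.
    have : rho%:R <= 96 * 4 ^+ J.+1 :> R.
      rewrite -natrX -natrM ler_nat; move: J2; rewrite ltn_divLR// mulnC => /ltnW.
      by [].
    have : 0 <= dl ^+ 2 by rewrite exprn_ge0.
    nra.
  have sv : 1 - 10 * s - 64 * s <= \sum_(j < J.+1) v j.
    rewrite sumv; have : 0 <= (3 / 4) ^+ J.+1 :> R by rewrite exprn_ge0.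
    nra.
  apply: (@le_trans _ _ (\sum_(j < J.+1) v j * (1 - 3 * dl))); last first.
    by apply: ler_sum => j _; apply: vw; rewrite -ltnS.
  rewrite -mulr_suml; apply: (@le_trans _ _ ((1 - 74 * s) * (1 - 3 * dl)));
    first by nra.
  by apply: ler_wpM2r; lra.
have [h|h] := leP (2 * 77 * s) 1.
  apply: le_trans lb1; rewrite -div1r ler_pdivrMr; nra.
apply: le_trans lb0; rewrite lef_pV2 ?posrE; lra.
Qed.
End Constants.

(** * Measurability of the selection event, and the competitive ratio *)

Lemma measurable_ALG_event {d} {T : measurableType d} {R : realType}
    (P : probability T R) {n : nat} {disp} {E : finOrderType disp}
    (U : 'I_n -> {RV P >-> R}) (r : T -> {ffun 'I_n -> E}) rho eps e :
  uniform_order P r ->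
  measurable [set w | e \in ALG rho eps (sorted_times U w) (r w)].
Proof.
move=> [rI rm]; rewrite [X in measurable X](_ : _ =
  \bigcup_(s in [set s : {ffun 'I_n -> E} | injective s])
    (r @^-1` [set s] `&` [set w | e \in ALG rho eps (sorted_times U w) s])).
  apply: fin_bigcup_measurable => [|s sI]; first exact: finite_finset.
  apply: measurableI; first by have [] := rm s sI.
  apply: measurable_mem_ALG => i; apply: measurable_sort => k.
  exact: measurable_funP.
by apply/seteqP; split=> [w h|w [s _ [/= <-]]]//; exists (r w) => //; exact: rI.
Qed.

Theorem theorem10 (R : realType) :
  exists C : R, 0 < C /\
  forall (n rho : nat) (disp : Order.disp_t) (E : finOrderType disp)
    (eps : nat -> R)
    (d : measure_display) (T : measurableType d) (P : probability T R)
    (U : 'I_n -> {RV P >-> R}) (r : T -> {ffun 'I_n -> E}),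
    (96 <= rho)%N -> (rho <= n)%N -> #|E| = n ->
    eps_spec rho eps ->
    uniform_times U -> uniform_order P r -> independent_order_times r U ->
    prob_competitive P rho (1 + C * Num.sqrt (ln rho%:R / rho%:R))
      (fun w : T => ALG rho eps (sorted_times U w) (r w)).
Proof.
exists (2 * 77 * 231); split; first by rewrite !mulr_gt0.
move=> n rho disp E eps d T P U r h96 _ cardE epsP uU ur ind e eO.
apply: (@le_trans _ _ (\sum_(j < (trunc_log 4 (rho %/ 96)).+1)
    window_weight rho eps j)%:E).
  by rewrite lee_fin; exact: window_sum_ge.
set J := trunc_log _ _.
have jrho (j : 'I_J.+1) : (96 * 4 ^ j <= rho)%N.
  have q0 : (0 < rho %/ 96)%N by rewrite divn_gt0.
  have /andP[J1 _] := trunc_log_bounds (isT : 1 < 4)%N q0.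
  rewrite mulnC -leq_divRL//; apply: leq_trans J1.
  by rewrite leq_pexp2l// -ltnS.
have rho0 : (0 < rho)%N by exact: leq_trans h96.
have ex (j : 'I_J.+1) := let: And4 h1 h2 h3 _ :=
  eps_facts h96 (jrho j) (eps_prescribed h96 epsP (jrho j)) in
  accept_window uU ur ind cardE rho0 h1 h2 h3 eO.
have /choice[G GP] := ex.
apply: (@le_trans _ _ (\sum_(j < J.+1) P (G j))%E).
  by rewrite -sumEFin; apply: lee_sum => j _; have [] := GP j.
have mG j : measurable (G j) by have [] := GP j.
(* The events [G j] are disjoint, since [e] arrives in at most one [J_ j]; their union lies in the
   event that [e] is selected. *)
rewrite -measure_semi_additive_ord//.
- apply: le_measure.
  + by apply: mem_set; apply: bigsetU_measurable => j _.
  + by apply: mem_set; exact: measurable_ALG_event.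
  + by rewrite -bigcup_seq => w [j _ Gj]; have [_ /(_ w Gj)[]] := GP j.
- move=> i j _ _ [w [Gi Gj]]; apply: val_inj.
  have [_ /(_ w Gi)[ti _] _] := GP i; have [_ /(_ w Gj)[tj _] _] := GP j.
  exact: J_disjoint ti tj.
- by apply: bigsetU_measurable => j _.
Qed.
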